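(* Let $a_0,\ldots,a_n\in\mathbb{N}_0$, let $c_1,\ldots,c_k$ be integers, and assume there exist polynomials $P_1(X),\ldots,P_k(X)\in\mathbb{Z}[X]$ such that $$P_1(X)\approx\ldots\approx P_k(X)\approx\sum_{i=0}^n a_iX^i\quad\text{and}\quad c_1P_1(X)+\ldots+c_kP_k(X)=0.$$ Then for every idempotent ultrafilter $\mathcal{U}$ and every $A\in a_0\,\mathcal{U}\oplus\ldots\oplus a_n\,\mathcal{U}$ there exist $x_1,\ldots,x_k\in A$ with $c_1x_1+\ldots+c_kx_k=0$. Moreover, if the polynomials $P_1,\ldots,P_k$ are pairwise distinct, then $x_1,\ldots,x_k$ can be chosen pairwise distinct.
   Context: $\mathbb{N}$ denotes the positive integers and $\mathbb{N}_0=\mathbb{N}\cup\{0\}$. All ultrafilters are on $\mathbb{N}_0$. The pseudo-sum is defined by $A\in\mathcal{U}\oplus\mathcal{V}$ iff $\{n\in\mathbb{N}_0: A-n\in\mathcal{V}\}\in\mathcal{U}$, where $A-n=\{m\in\mathbb{N}_0: m+n\in A\}$; it is associative. For $h\in\mathbb{N}_0$, $A\in h\,\mathcal{U}$ iff $\{n: nh\in A\}\in\mathcal{U}$. An idempotent ultrafilter is a non-principal $\mathcal{U}$ with $\mathcal{U}\oplus\mathcal{U}=\mathcal{U}$. The $u$-equivalence $\approx$ on finite strings of integers is the smallest equivalence relation such that: the empty string is equivalent to $\langle 0\rangle$; $\langle a\rangle\approx\langle a,a\rangle$ for every integer $a$; and if $\sigma\approx\sigma'$ and $\tau\approx\tau'$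 then the concatenations satisfy $\sigma^\frown\tau\approx\sigma'^\frown\tau'$. Two polynomials $\sum_{i=0}^n a_iX^i$ and $\sum_{j=0}^m b_jX^j$ in $\mathbb{Z}[X]$ are $u$-equivalent ($\approx$) if their coefficient strings $\langle a_0,\ldots,a_n\rangle$ and $\langle b_0,\ldots,b_m\rangle$ are $u$-equivalent. *)

(* Defs.v *)
From mathcomp Require Import all_boot all_order all_algebra.
From mathcomp Require Import boolp classical_sets filter.
Set Implicit Arguments.
Unset Strict Implicit.
Unset Printing Implicit Defensive.
Import GRing.Theory.
Local Open Scope classical_set_scope.

Definition shift (A : set nat) (n : nat) : set nat := [set m | A (m + n)%N].

Definition pseudo_sum (U V : set_system nat) : set_system nat :=
  [set A | U [set n | V (shift A n)]].

Definition mul_uf (h : nat) (U : set_system nat) : set_system nat :=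
  [set A | U [set n | A (n * h)%N]].

Definition idempotent_ultrafilter (U : set_system nat) : Prop :=
  [/\ UltraFilter U,
      forall x : nat, U <> principal_filter x
    & pseudo_sum U U = U].

(* [lin_uf a n U] is a_0 U (+) ... (+) a_n U, bracketed to the left; only the
   values a 0, ..., a n are used. The bracketing is immaterial, since the
   pseudo-sum is associative. *)
Fixpoint lin_uf (a : nat -> nat) (n : nat) (U : set_system nat)
    : set_system nat :=
  if n is m.+1 then pseudo_sum (lin_uf a m U) (mul_uf (a m.+1) U)
  else mul_uf (a 0%N) U.

Lemma pseudo_sumA (U V W : set_system nat) :
  pseudo_sum U (pseudo_sum V W) = pseudo_sum (pseudo_sum U V) W.
Proof.
rewrite /pseudo_sum; apply/funext => A /=; congr U; apply/funext => n /=.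
congr V; apply/funext => m /=; congr W; apply/funext => k.
by rewrite /shift /= -addnA.
Qed.

Inductive ueq : seq int -> seq int -> Prop :=
| ueq_refl s : ueq s s
| ueq_sym s t : ueq s t -> ueq t s
| ueq_trans s t r : ueq s t -> ueq t r -> ueq s r
| ueq_nil : ueq [::] [:: 0%R]
| ueq_dup a : ueq [:: a] [:: a; a]
| ueq_cat s s' t t' : ueq s s' -> ueq t t' -> ueq (s ++ t) (s' ++ t').

(* The coefficient string of p is [polyseq p], which has no trailing zeros;
   by [ueq_Poly], any other coefficient string of p would do as well. *)
Definition poly_ueq (p q : {poly int}) : Prop := ueq (polyseq p) (polyseq q).

Lemma ueq_Poly (s : seq int) : ueq (polyseq (Poly s)) s.
Proof.
elim: s => [|a s IHs]; first by rewrite polyseq0; exact: ueq_refl.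
rewrite /= polyseq_cons; case: nilP => [s0|_] /=; last first.
  exact: (ueq_cat (ueq_refl [:: a]) IHs).
rewrite s0 in IHs; rewrite polyseqC; case: eqP => [->|_] /=.
  exact: (ueq_cat ueq_nil IHs).
exact: (ueq_cat (ueq_refl [:: a]) IHs).
Qed.

(* Main.v *)
Require Import Defs.
From mathcomp Require Import all_boot all_order all_algebra.
From mathcomp Require Import boolp classical_sets filter.
Set Implicit Arguments.
Unset Strict Implicit.
Unset Printing Implicit Defensive.
Import GRing.Theory.
Local Open Scope classical_set_scope.
Local Open Scope ring_scope.

(** The ultrafilter [b_0 U (+) ... (+) b_m U] depends only on the u-equivalence
class of the string [b], because [0 U] is neutral and [h U (+) h U = h U] for
idempotent [U]. Hence, after padding the [P_i] to a common length [m], the set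
[A] belongs to the ultrafilter attached to each of them, which says that
[sum_j P_ij v_j] lies in [A] for [U]-many [v_0], ..., for [U]-many [v_(m-1)].
A vector [v] good for all [i] at once yields [x_i = sum_j P_ij v_j], and the
relation between the [P_i] carries over coefficientwise. As [U] is not
principal, a nonzero linear form is nonzero at [U]-many [v_0], ...,
[v_(m-1)], so distinct [P_i] can be made to give distinct [x_i]. *)

(** Starting from the neutral element gives the empty string a meaning, and concatenation of strings
    becomes the pseudo-sum. *)
Definition string_uf (U : set_system nat) (s : seq nat) : set_system nat :=
  foldr (fun h => pseudo_sum (mul_uf h U)) (principal_filter 0%N) s.

(** This is the [m]-fold tensor power of [U], living on lists of length [m]; the first entry is
    quantified outermost. *)
Fixpoint iter_many (U : set_system nat) (m : nat) (Q : set (seq nat)) : Prop :=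
  if m is m'.+1 then U [set n | iter_many U m' [set v | Q (n :: v)]]
  else Q [::].

Lemma shift0 (A : set nat) : shift A 0 = A.
Proof. by apply/funext => m; rewrite /shift /= addn0. Qed.

Lemma pseudo_sum0l (U : set_system nat) :
  pseudo_sum (principal_filter 0%N) U = U.
Proof.
apply/funext => A; apply/propext; rewrite /pseudo_sum /=.
by rewrite principal_filterP /= shift0.
Qed.

Lemma mul_uf0 (U : set_system nat) :
  ProperFilter U -> mul_uf 0 U = principal_filter 0%N.
Proof.
move=> UF; apply/funext => A; apply/propext; rewrite principal_filterP.
rewrite /mul_uf /=; split=> [/filter_ex[n /=]|A0]; first by rewrite muln0.
by apply: filterS filterT => n _ /=; rewrite muln0.
Qed.

Lemma pseudo_sum_mul (h : nat) (U V : set_system nat) :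
  pseudo_sum (mul_uf h U) (mul_uf h V) = mul_uf h (pseudo_sum U V).
Proof.
apply/funext => A; rewrite /pseudo_sum /mul_uf /=; congr U.
apply/funext => n /=; congr V; apply/funext => m /=.
by rewrite /shift /= mulnDl.
Qed.

Lemma string_uf_cat (U : set_system nat) (s t : seq nat) :
  string_uf U (s ++ t) = pseudo_sum (string_uf U s) (string_uf U t).
Proof.
elim: s => [|h s IHs] /=; first by rewrite pseudo_sum0l.
by rewrite IHs pseudo_sumA.
Qed.

Lemma string_uf_seq1 (U : set_system nat) (h : nat) :
  string_uf U [:: h] = mul_uf h U.
Proof.
apply/funext => A; apply/propext; rewrite /= /pseudo_sum /mul_uf /=.
have -> // : [set n | principal_filter 0%N (shift A (n * h)%N)] =
             [set n | A (n * h)%N].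
by apply/funext => n; apply/propext; rewrite /= principal_filterP.
Qed.

Lemma lin_ufE (a : nat -> nat) (n : nat) (U : set_system nat) :
  lin_uf a n U = string_uf U (mkseq a n.+1).
Proof.
elim: n => [|n IHn]; first by rewrite string_uf_seq1.
by rewrite mkseqS -cats1 string_uf_cat string_uf_seq1 -IHn.
Qed.

(** A chain of u-equivalences may pass through arbitrary integer strings; [absz] attaches an
    ultrafilter to each of them, so the induction needs no sign condition. *)
Lemma ueq_string_uf (U : set_system nat) (s t : seq int) :
  idempotent_ultrafilter U -> ueq s t ->
  string_uf U (map absz s) = string_uf U (map absz t).
Proof.
move=> [UU _ Uid]; elim=> {s t} [//|//| | | |].
- by move=> s t r _ -> _ ->.
- by rewrite string_uf_seq1 mul_uf0.
- move=> a; rewrite -[map _ [:: a; a]]/([:: `|a|%N] ++ [:: `|a|%N]).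
  by rewrite string_uf_cat string_uf_seq1 pseudo_sum_mul Uid.
- by move=> s s' t t' _ IHs _ IHt; rewrite !map_cat !string_uf_cat IHs IHt.
Qed.

(** This invariant forces the coefficients of every [P i] to be nonnegative, so that passing to
    [absz] loses nothing. *)
Lemma ueq_nonneg (s t : seq int) :
  ueq s t -> all (>= 0) s = all (>= 0) t.
Proof.
elim=> {s t} [//|//| | |a |].
- by move=> s t r _ -> _ ->.
- by [].
- by rewrite /= !andbT andbb.
- by move=> s s' t t' _ IHs _ IHt; rewrite !all_cat IHs IHt.
Qed.

(** Used to pad coefficient strings with zeros up to a prescribed length. *)
Lemma polyseq_ueq_mkseq (p : {poly int}) (m : nat) (f : nat -> int) :
  (forall j, p`_j = if (j < m)%N then f j else 0) ->
  ueq p (mkseq f m).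
Proof.
move=> pE; suff -> : p = Poly (mkseq f m) by exact: ueq_Poly.
apply/polyP => j; rewrite coef_Poly pE; case: ltnP => jm.
  by rewrite nth_mkseq.
by rewrite nth_default // size_mkseq.
Qed.

Lemma iter_manyT (U : set_system nat) {UF : Filter U} (m : nat) :
  iter_many U m setT.
Proof. by elim: m => //= m IHm; apply: filterS filterT. Qed.

Lemma iter_manyS (U : set_system nat) {UF : Filter U} (m : nat)
    (Q R : set (seq nat)) :
  Q `<=` R -> iter_many U m Q -> iter_many U m R.
Proof.
elim: m Q R => [|m IHm] Q R QR /=; first exact: QR.
by apply: filterS => n /=; apply: IHm => v /=; exact: QR.
Qed.

Lemma iter_manyI (U : set_system nat) {UF : Filter U} (m : nat)
    (Q R : set (seq nat)) :
  iter_many U m Q -> iter_many U m R -> iter_many U m (Q `&` R).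
Proof.
elim: m Q R => [|m IHm] Q R //= UQ UR.
by apply: filterS (filterI UQ UR) => n [/= Qn Rn]; exact: IHm Qn Rn.
Qed.

Lemma iter_many_forall (U : set_system nat) {UF : Filter U} (m : nat)
    (I : finType) (Q : I -> set (seq nat)) :
  (forall i, iter_many U m (Q i)) ->
  iter_many U m [set v | forall i, Q i v].
Proof.
move=> UQ.
suff /(_ (enum I)): forall r : seq I,
    iter_many U m [set v | {in r, forall i, Q i v}].
  by apply: iter_manyS => v /= Qv i; apply: Qv; rewrite mem_enum.
elim=> [|i r IHr]; first by apply: iter_manyS (iter_manyT m) => v _ i.
apply: iter_manyS (iter_manyI (UQ i) IHr) => v [Qi Qr] j.
by rewrite inE => /predU1P[->|]; [|exact: Qr].
Qed.

Lemma iter_many_ex (U : set_system nat) {UF : ProperFilter U} (m : nat)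
    (Q : set (seq nat)) :
  iter_many U m Q -> exists v, Q v.
Proof.
elim: m Q => [|m IHm] Q /=; first by exists [::].
by move=> /filter_ex[n /IHm[v Qv]]; exists (n :: v).
Qed.

Lemma string_ufP (U : set_system nat) (m : nat) (f : nat -> nat) (A : set nat) :
  string_uf U (mkseq f m) A <->
  iter_many U m [set v | A (\sum_(j < m) nth 0 v j * f j)%N].
Proof.
elim: m f A => [|m IHm] f A; first by rewrite /= principal_filterP big_ord0.
(* The tail of the string is reindexed as [mkseq (f \o S) m], to which the induction hypothesis
   applies with a shifted set. *)
rewrite /mkseq /= -[1%N]addn0 iotaDl -map_comp /pseudo_sum /mul_uf /=.
have -> // : (fun n => string_uf U (mkseq (f \o S) m) (shift A (n * f 0)%N)) =
    (fun n => iter_many U m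
      [set v | A (\sum_(j < m.+1) nth 0 (n :: v) j * f j)%N]).
apply/funext => n; apply/propext; rewrite IHm /shift.
set Q := (X in iter_many U m X); set R := (X in _ <-> iter_many U m X).
suff -> : Q = R by [].
by apply/funext => v; rewrite /Q /R /= big_ord_recl addnC.
Qed.

(** If [[set x]] were in [U], every member of [U] would contain [x], and maximality would make [U]
    principal. *)
Lemma nonprincipal_neq (U : set_system nat) (x : nat) :
  UltraFilter U -> U <> principal_filter x -> U [set n | n <> x].
Proof.
move=> UU Ux; have [Ux1|//] := in_ultra_setVsetC [set x] UU.
case: Ux; apply/esym/max_filter; first exact: principal_filter_proper.
by move=> B /(filterI Ux1)/filter_ex[y [-> Bx]]; apply/principal_filterP.
Qed.

(** The constant [t] collects the terms already chosen. Only the entry at the last nonzero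
    coefficient has to be restricted; all others are free. *)
Lemma iter_many_sum_neq0 (U : set_system nat) (m : nat) (d : nat -> int)
    (t : int) :
  UltraFilter U -> (forall x, U <> principal_filter x) ->
  (t != 0) || [exists j : 'I_m, d j != 0] ->
  iter_many U m [set v | t + \sum_(j < m) (nth 0%N v j)%:Z * d j <> 0].
Proof.
move=> UU Unp; elim: m d t => [|m IHm] d t td /=.
  rewrite big_ord0 addr0; apply/eqP; case/orP: td => // /existsP[[]] //.
have step n : (t + n%:Z * d 0%N != 0) || [exists j : 'I_m, d j.+1 != 0] ->
    iter_many U m
      [set v | t + \sum_(j < m.+1) (nth 0%N (n :: v) j)%:Z * d j <> 0].
  move=> /(IHm (d \o S)); apply: iter_manyS => v.
  by rewrite /= big_ord_recl addrA.
have [dS|dS] := boolP [exists j : 'I_m, d j.+1 != 0].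
  by apply: filterS filterT => n _; apply: step; rewrite dS orbT.
(* All later coefficients vanish now, so the updated constant itself has to be nonzero. *)
have [d0|d0] := eqVneq (d 0%N) 0.
  apply: filterS filterT => n _; apply: step; rewrite d0 mulr0 addr0.
  case/orP: td => [->//|/existsP[j dj]]; move: dj.
  case: (unliftP ord0 j) => [i ->|->]; last by rewrite d0 eqxx.
  by move=> di; case/existsP: dS; exists i.
(* At most one natural number is a root, and non-principality lets [n] avoid it. *)
have [[x tx]|tx] := pselect (exists x : nat, t + x%:Z * d 0%N = 0).
  apply: filterS (nonprincipal_neq UU (Unp x)) => n nx; apply: step.
  apply/orP; left; apply/eqP => tn; apply: nx.
  by move: tn; rewrite -tx => /addrI/(mulIf d0)[].
apply: filterS filterT => n _; apply: step; apply/orP; left.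
by apply/eqP => tn; apply: tx; exists n.
Qed.

Theorem theorem4p4 (n k : nat) (a : nat -> nat) (c : 'I_k -> int)
    (P : 'I_k -> {poly int})
    (hP : forall i : 'I_k,
        poly_ueq (P i) (\sum_(j < n.+1) (a j)%:Z *: 'X^j))
    (hc : \sum_(i < k) c i *: P i = 0)
    (U : set_system nat) (hU : idempotent_ultrafilter U)
    (A : set nat) (hA : lin_uf a n U A) :
  (exists x : 'I_k -> nat,
      (forall i, A (x i)) /\ \sum_(i < k) c i * (x i)%:Z = 0) /\
  ((forall i j : 'I_k, i <> j -> P i <> P j) ->
   exists x : 'I_k -> nat,
     [/\ forall i, A (x i),
         \sum_(i < k) c i * (x i)%:Z = 0
       & forall i j : 'I_k, i <> j -> x i <> x j]).
Proof.
have [UU Unp Uid] := hU.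
pose m := (\max_(i < k) size (P i))%N.
have P_m i j : (m <= j)%N -> (P i)`_j = 0.
  move=> mj; rewrite nth_default // (leq_trans _ mj) //.
  exact: (leq_bigmax (F := fun i => size (P i)) i).
pose f i j := absz (P i)`_j.
have ueqa i : ueq (P i) (mkseq (fun j => (a j)%:Z) n.+1).
  apply: ueq_trans (hP i) _; apply: polyseq_ueq_mkseq => j.
  by rewrite -(poly_def n.+1 (fun l => (a l)%:Z)) coef_poly.
have Pf i j : (P i)`_j = (f i j)%:Z.
  have /all_nthP P0 : all (>= 0) (P i).
    by rewrite (ueq_nonneg (ueqa i)); apply/allP => _ /mapP[l _ ->].
  have [ji|ij] := ltnP j (size (polyseq (P i))); first by rewrite /f gez0_abs ?P0.
  by rewrite /f nth_default.
have fA i : iter_many U m [set v | A (\sum_(j < m) nth 0 v j * f i j)%N].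
  apply/string_ufP.
  have Pm : ueq (P i) (mkseq (fun j => (f i j)%:Z) m).
    apply: polyseq_ueq_mkseq => j; case: ltnP => [_|/P_m -> //].
    exact: Pf.
  have := ueq_string_uf hU (ueq_trans (ueq_sym Pm) (ueqa i)).
  by rewrite /mkseq -!map_comp => ->; rewrite -[map _ _]/(mkseq a n.+1) -lin_ufE.
pose x v i := (\sum_(j < m) nth 0 v j * f i j)%N.
have xE v i : (x v i)%:Z = \sum_(j < m) (nth 0%N v j)%:Z * (P i)`_j.
  rewrite /x (big_morph Posz PoszD (erefl _)); apply: eq_bigr => j _.
  by rewrite PoszM Pf.
have cx v : \sum_(i < k) c i * (x v i)%:Z = 0.
  under eq_bigr do rewrite xE mulr_sumr.
  rewrite exchange_big big1 //= => j _.
  have := congr1 (fun p : {poly int} => p`_j) hc.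
  rewrite coef0 coef_sum => cPj.
  transitivity ((nth 0%N v j)%:Z * \sum_(i < k) c i * (P i)`_j).
    by rewrite mulr_sumr; apply: eq_bigr => i _; rewrite mulrCA.
  by under eq_bigr do rewrite -coefZ; rewrite cPj mulr0.
have xA : iter_many U m [set v | forall i, A (x v i)].
  exact: iter_many_forall fA.
split=> [|Pinj].
  by have [v vA] := iter_many_ex xA; exists (x v).
(* Indexing by pairs gives a single finite family for [iter_many_forall]; the implication makes the
   diagonal trivial. *)
have xneq (ij : 'I_k * 'I_k) :
    iter_many U m [set v | ij.1 <> ij.2 -> x v ij.1 <> x v ij.2].
  case: ij => i j /=; have [->|neij] := eqVneq i j.
    by apply: iter_manyS (iter_manyT m) => v _ /(_ erefl).
  (* The linear form has constant term 0. Distinct [P i] and [P j] differ at an index below [m],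
     since both vanish from [m] on. *)
  have : (0 != 0 :> int) || [exists l : 'I_m, (P i)`_l - (P j)`_l != 0].
    rewrite eqxx /=; apply/existsP; apply: contrapT => noteq.
    apply: (Pinj i j (elimN eqP neij)); apply/polyP => l.
    have [lm|ml] := ltnP l m; last by rewrite !P_m.
    apply/eqP; rewrite -subr_eq0; apply: contrapT => /negP Pl.
    by apply: noteq; exists (Ordinal lm).
  move=> /(iter_many_sum_neq0 (m := m) (d := fun l => (P i)`_l - (P j)`_l) UU Unp).
  apply: iter_manyS => v /= + _ xij; apply.
  rewrite add0r; under eq_bigr do rewrite mulrBr.
  by rewrite sumrB -!xE xij subrr.
have [v [vA vneq]] := iter_many_ex (iter_manyI xA (iter_many_forall xneq)).
by exists (x v); split=> // i j; exact: (vneq (i, j)).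
Qed.
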